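(* Assume monotone protection and follow-through uncertainty. Then: (i) (Bound.) Every decentralized public process that is regret-free has $C_t\subseteq C^-(S)$ for every date $t$ and every realization. (ii) (Attainment.) The greedy process, given by $A_t=T(C_{t-1})\setminus C_{t-1}$, is regret-free and, in the realization in which every attempted action is completed ($R_t=A_t$ for all $t$), reaches exactly $C^-(S)$ in at most $|S|$ dates. (iii) (Lattice position.) $C^-(S)$ is the least fixed point of $\Gamma$ and $C^+(S)$ is the greatest fixed point of $\Gamma$; the fixed points of $\Gamma$ form a complete lattice, on the domain $\{C: C_0\subseteq C\subseteq C_0\cup S\}$ ordered by inclusion.
   Context: Setting. $C_0$ (the vanguard, possibly empty) and $N$ are disjoint finite sets of people; $S\subseteq N$ is the set of supporters. A coalition is a set $C$ with $C_0\subseteq C\subseteq C_0\cup S$. For each $i\in C_0\cup S$ a protection family $\mathcal P_i$ is given, consisting of coalitions that contain $i$. Standing assumption: $C_0\in\mathcal P_i$ for every $i\in C_0$. Monotone protection: for all $i$ and all coalitions $C\subseteq C'$ with $C\in\mathcal P_i$, also $C'\in\mathcal P_i$. A coalition $C$ is self-protecting if $C\in\mathcal P_i$ for every $i\in C$. Operators on coalitions: $T(C)=C\cup\{i\in S\setminus C: C\cup\{i\}\in\mathcal P_i\}$ and $\Gamma(C)=C_0\cup\{i\in S: C\cup\{i\}\in\mathcal P_i\}$. Define $C^-(S)=T^{|S|}(C_0)$ and $C^+(S)=\bigcup\{C: C\text{ a self-protecting coalition}\}$. Decentralized public process: dates $t=1,2,\dots$; starting from $C_0$, at date $t$ a set $A_t\subseteq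 S\setminus C_{t-1}$ of people, determined by the prior public history only, attempts to go public; a subset $R_t\subseteq A_t$ of attempts is completed, and $C_t=C_{t-1}\cup R_t$. The current attempts are unverified before exposure. Follow-through uncertainty: for every $R\subseteq A_t$ the realization $R_t=R$ is admissible (in particular $R_t=\{i\}$ for each $i\in A_t$). The process is regret-free if for every date $t$, every admissible realization path, and every $i\in C_t$, $C_t\in\mathcal P_i$. *)

(* Defs.v *)
From mathcomp Require Import all_boot.

Set Implicit Arguments.
Unset Strict Implicit.
Unset Printing Implicit Defensive.

(* People are elements of a finite type [I]; the vanguard [C0],
   the population [N] and the supporters [S] are subsets of it, and the
   protection families are given by [P : I -> {set {set I}}], of which only the
   values at members of [C0 :|: S] matter. *)

Definition coalition (I : finType) (C0 S C : {set I}) : bool :=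
  (C0 \subset C) && (C \subset C0 :|: S).

Definition protection_families (I : finType) (C0 S : {set I})
    (P : I -> {set {set I}}) : Prop :=
  (forall (i : I) (C : {set I}), i \in C0 :|: S -> C \in P i ->
     coalition C0 S C /\ i \in C) /\
  (forall i : I, i \in C0 -> C0 \in P i).

Definition monotone_protection (I : finType) (C0 S : {set I})
    (P : I -> {set {set I}}) : Prop :=
  forall (i : I) (C C' : {set I}), i \in C0 :|: S ->
    coalition C0 S C -> coalition C0 S C' -> C \subset C' ->
    C \in P i -> C' \in P i.

Definition self_protecting (I : finType) (P : I -> {set {set I}})
    (C : {set I}) : bool :=
  [forall i in C, C \in P i].

Definition Tmap (I : finType) (S : {set I}) (P : I -> {set {set I}})
    (C : {set I}) : {set I} :=
  C :|: [set i in S :\: C | (C :|: [set i]) \in P i].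

Definition Gamma (I : finType) (C0 S : {set I}) (P : I -> {set {set I}})
    (C : {set I}) : {set I} :=
  C0 :|: [set i in S | (C :|: [set i]) \in P i].

Definition Cminus (I : finType) (C0 S : {set I}) (P : I -> {set {set I}}) :
    {set I} :=
  iter #|S| (Tmap S P) C0.

Definition Cplus (I : finType) (C0 S : {set I}) (P : I -> {set {set I}}) :
    {set I} :=
  \bigcup_(C : {set I} | coalition C0 S C && self_protecting P C) C.

(* A process is the map sending the public history [:: R_1; ...; R_(t-1)] of
   completed attempts, oldest first, to the set A_t of attempts made at date t;
   past attempts are themselves functions of such a history, so recording them
   too would add no information. *)
Definition process (I : finType) : Type := seq {set I} -> {set I}.

(* A realization path gives R_t as [R t] for the dates t >= 1; the value [R 0]
   is never used. *)
Definition history (I : finType) (R : nat -> {set I}) (t : nat) :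
    seq {set I} :=
  [seq R s | s <- iota 1 t].

Definition coalition_after (I : finType) (C0 : {set I}) (h : seq {set I}) :
    {set I} :=
  foldl (fun C Rt : {set I} => C :|: Rt) C0 h.

Definition coalition_at (I : finType) (C0 : {set I}) (R : nat -> {set I})
    (t : nat) : {set I} :=
  coalition_after C0 (history R t).

Definition attempts_at (I : finType) (A : process I) (R : nat -> {set I})
    (t : nat) : {set I} :=
  A (history R t.-1).

(* Follow-through uncertainty: no subset of A_t is excluded as a realization. *)
Definition admissible (I : finType) (A : process I) (R : nat -> {set I}) :
    Prop :=
  forall t : nat, 0 < t -> R t \subset attempts_at A R t.

Definition public_process (I : finType) (C0 S : {set I}) (A : process I) :
    Prop :=
  forall R : nat -> {set I}, admissible A R ->
  forall t : nat, 0 < t ->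
    attempts_at A R t \subset S :\: coalition_at C0 R t.-1.

Definition regret_free (I : finType) (C0 : {set I}) (P : I -> {set {set I}})
    (A : process I) : Prop :=
  forall R : nat -> {set I}, admissible A R ->
  forall t : nat, 0 < t ->
  forall i : I, i \in coalition_at C0 R t -> coalition_at C0 R t \in P i.

Definition greedy (I : finType) (C0 S : {set I}) (P : I -> {set {set I}}) :
    process I :=
  fun h => let C := coalition_after C0 h in Tmap S P C :\: C.

Definition all_completed (I : finType) (A : process I) (R : nat -> {set I}) :
    Prop :=
  forall t : nat, 0 < t -> R t = attempts_at A R t.

Lemma all_completed_exists (I : finType) (A : process I) :
  exists R : nat -> {set I}, all_completed A R.
Proof.
pose h := fix h t := if t is s.+1 then rcons (h s) (A (h s)) else [::].
exists (fun t => A (h t.-1)) => -[//|t] _; rewrite /attempts_at /=.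
congr A; elim: t => [//|t IH].
by rewrite /history -addn1 iotaD map_cat /= cats1 -/(history _ _) -IH addn1.
Qed.

Definition fixed_points (I : finType) (C0 S : {set I})
    (P : I -> {set {set I}}) : {set {set I}} :=
  [set C : {set I} | coalition C0 S C & Gamma C0 S P C == C].

Definition least_in (I : finType) (F : {set {set I}}) (X : {set I}) : Prop :=
  X \in F /\ forall Y : {set I}, Y \in F -> X \subset Y.

Definition greatest_in (I : finType) (F : {set {set I}}) (X : {set I}) :
    Prop :=
  X \in F /\ forall Y : {set I}, Y \in F -> Y \subset X.

(* Bounds are taken inside [F], not in the ambient powerset, and the empty
   family is allowed. *)
Definition complete_lattice (I : finType) (F : {set {set I}}) : Prop :=
  forall G : {set {set I}}, G \subset F ->
    (exists X : {set I},
       least_in [set U in F | [forall Y in G, Y \subset U]] X) /\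
    (exists X : {set I},
       greatest_in [set L in F | [forall Y in G, L \subset Y]] X).

(* Main.v *)
Require Import Defs.
From mathcomp Require Import all_boot.

(** Under monotone protection, [Tmap] is monotone on coalitions and preserves
    self-protection, and the fixed points of [Gamma] are exactly the
    self-protecting coalitions closed under [Tmap]. Iterating [Tmap] from a
    self-protecting coalition [C] adds a new supporter at each step until it
    stabilises, hence yields after [#|S|] steps the least fixed point of [Gamma]
    above [C]: this gives [Cminus] and all joins. A regret-free process
    can only let [i] attempt at [C] if [C :|: [set i]] protects [i], since [i]
    may turn out to be the only one to follow through; so it never leaves
    [Cminus]. *)

Set Implicit Arguments.
Unset Strict Implicit.
Unset Printing Implicit Defensive.

(** Each application before stabilisation adds an element. If no fixed point is met within [n]
    steps, the [n]-th iterate has at least [#|A| + n] elements, so it exhausts [B], and the next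
    iterate has no room left to grow. *)
Lemma iter_extensive_fixed (T : finType) (f : {set T} -> {set T})
    (A B : {set T}) (n : nat) :
  (forall X : {set T}, X \subset f X) ->
  (forall k : nat, iter k f A \subset B) -> #|B| <= #|A| + n ->
  f (iter n f A) = iter n f A.
Proof.
move=> f_ext f_bound card_le.
have stable_or_grow k :
    f (iter k f A) = iter k f A \/ #|A| + k <= #|iter k f A|.
  elim: k => [|k [IH|IH]]; first by right; rewrite addn0.
    by left; rewrite iterS IH IH.
  have [fE|fN] := eqVneq (f (iter k f A)) (iter k f A).
    by left; rewrite iterS fE fE.
  right; rewrite addnS iterS (leq_ltn_trans IH) // proper_card //.
  by rewrite properEneq eq_sym fN f_ext.
have [//|card_ge] := stable_or_grow n.
have iterE : iter n f A = B.
  by apply/eqP; rewrite eqEcard f_bound (leq_trans card_le).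
by apply/eqP; rewrite eqEsubset f_ext andbT {2}iterE -iterS f_bound.
Qed.

(* The meet of [G] is the join of its lower bounds in [F]. *)
Lemma complete_lattice_of_joins (I : finType) (F : {set {set I}}) :
  (forall G : {set {set I}}, G \subset F ->
     exists X : {set I},
       least_in [set U in F | [forall Y in G, Y \subset U]] X) ->
  complete_lattice F.
Proof.
move=> joins G GF; split; first exact: joins.
pose L := [set L in F | [forall Y in G, L \subset Y]].
have LF : L \subset F by apply/subsetP => Y /setIdP[].
have [X [/setIdP[XF /forall_inP Xub] Xmin]] := joins L LF.
exists X; split=> [|Y YL]; last exact: Xub.
rewrite inE XF /=; apply/forall_inP => Y YG; apply: Xmin.
rewrite inE (subsetP GF) //=; apply/forall_inP => Z.
by rewrite inE => /andP[_ /forall_inP]; apply.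
Qed.

Section Protection.

Variables (I : finType) (C0 S : {set I}) (P : I -> {set {set I}}).

(** * Coalitions and histories along a realization *)

Lemma coalition_atS (R : nat -> {set I}) (t : nat) :
  coalition_at C0 R t.+1 = coalition_at C0 R t :|: R t.+1.
Proof.
rewrite /coalition_at /history -(addn1 t) iotaD map_cat /coalition_after foldl_cat.
by rewrite /= add1n addn1.
Qed.

Lemma coalition_at_vanguard (R : nat -> {set I}) (t : nat) :
  C0 \subset coalition_at C0 R t.
Proof.
elim: t => [|t IH]; first exact: subxx.
by rewrite coalition_atS subsetU // IH.
Qed.

Lemma eq_history (R R' : nat -> {set I}) (t : nat) :
  (forall s : nat, s <= t -> R s = R' s) -> history R t = history R' t.
Proof.
move=> eqR; apply/eq_in_map => s; rewrite mem_iota add1n ltnS.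
by case/andP=> _; apply: eqR.
Qed.

(** * Iterates of [Tmap], without monotonicity *)

Lemma sub_Tmap (C : {set I}) : C \subset Tmap S P C.
Proof. exact: subsetUl. Qed.

Lemma sub_iter_Tmap (n : nat) (C : {set I}) : C \subset iter n (Tmap S P) C.
Proof.
by elim: n => [|n IH]; [exact: subxx | exact: subset_trans IH (sub_Tmap _)].
Qed.

Lemma coalitionU (C D : {set I}) :
  coalition C0 S C -> D \subset C0 :|: S -> coalition C0 S (C :|: D).
Proof.
by case/andP=> C0C CS DS; rewrite /coalition subUset CS DS subsetU // C0C.
Qed.

Lemma coalitionU1 (C : {set I}) (i : I) :
  coalition C0 S C -> i \in S -> coalition C0 S (C :|: [set i]).
Proof. by move=> cC iS; rewrite coalitionU // sub1set inE iS orbT. Qed.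

Lemma coalition_Tmap (C : {set I}) :
  coalition C0 S C -> coalition C0 S (Tmap S P C).
Proof.
move=> cC; rewrite coalitionU //; apply/subsetP => i.
by rewrite !inE => /andP[/andP[_ ->]]; rewrite orbT.
Qed.

Lemma coalition_iter_Tmap (n : nat) (C : {set I}) :
  coalition C0 S C -> coalition C0 S (iter n (Tmap S P) C).
Proof. by move=> cC; elim: n => //= n; apply: coalition_Tmap. Qed.

Lemma Tmap_iter_Tmap (C : {set I}) :
  coalition C0 S C ->
  Tmap S P (iter #|S| (Tmap S P) C) = iter #|S| (Tmap S P) C.
Proof.
(* All iterates lie in [C0 :|: S], which has at most [#|S|] elements more than [C] because [C]
   contains [C0]. *)
move=> cC; apply: (iter_extensive_fixed (B := C0 :|: S)); first exact: sub_Tmap.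
  by move=> k; have /andP[] := coalition_iter_Tmap k cC.
have /andP[C0C _] := cC.
by rewrite (leq_trans (leq_card_setU _ _)) // leq_add2r subset_leq_card.
Qed.

(** * Self-protection and fixed points under monotone protection *)

Hypothesis vanguard_protected : forall i : I, i \in C0 -> C0 \in P i.
Hypothesis mono : monotone_protection C0 S P.

Lemma coalition_vanguard : coalition C0 S C0.
Proof. by rewrite /coalition subxx subsetUl. Qed.

Lemma self_protecting_vanguard : self_protecting P C0.
Proof. by apply/forall_inP. Qed.

Lemma Tmap_mono (C D : {set I}) :
  coalition C0 S C -> coalition C0 S D -> C \subset D ->
  Tmap S P C \subset Tmap S P D.
Proof.
move=> cC cD CD; apply/subsetP => i; rewrite !inE.
case/orP=> [iC|/andP[/andP[_ iS] CiP]]; first by rewrite (subsetP CD).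
case: (boolP (i \in D)) => //= _; rewrite iS /=.
apply: mono CiP; rewrite ?inE ?iS ?orbT ?coalitionU1 //; exact: setSU.
Qed.

Lemma iter_Tmap_min (n : nat) (C D : {set I}) :
  coalition C0 S C -> coalition C0 S D -> C \subset D ->
  Tmap S P D = D -> iter n (Tmap S P) C \subset D.
Proof.
move=> cC cD CD TD; elim: n => //= n IH.
by rewrite -TD Tmap_mono // coalition_iter_Tmap.
Qed.

(** Old members stay protected by monotonicity, and a newcomer [i] is protected at [C :|: [set i]],
    which is contained in [D]. Allowing any [D] up to [Tmap S P C] covers partial follow-through in
    the greedy process. *)
Lemma self_protecting_between (C D : {set I}) :
  coalition C0 S C -> self_protecting P C ->
  C \subset D -> D \subset Tmap S P C -> self_protecting P D.
Proof.
move=> cC /forall_inP spC CD DT.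
have cD : coalition C0 S D.
  have /andP[C0C _] := cC; have /andP[_ TS] := coalition_Tmap cC.
  by rewrite /coalition (subset_trans C0C) // (subset_trans DT).
apply/forall_inP => i iD.
have iCS : i \in C0 :|: S by have /andP[_ /subsetP] := cD; apply.
have /setUP[iC|] := subsetP DT i iD; first exact: mono (spC i iC).
rewrite inE => /andP[/setDP[iS _] CiP].
by apply: mono CiP => //; rewrite ?coalitionU1 // subUset CD sub1set.
Qed.

Lemma self_protecting_iter_Tmap (n : nat) (C : {set I}) :
  coalition C0 S C -> self_protecting P C ->
  self_protecting P (iter n (Tmap S P) C).
Proof.
move=> cC spC; elim: n => //= n IH.
by apply: self_protecting_between IH _ _; rewrite ?sub_Tmap ?coalition_iter_Tmap.
Qed.

(** Each member inherits protection from the coalition of the family that contains it. Adding [C0]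
    keeps the union a coalition when [G] is empty. *)
Lemma self_protecting_bigcup (G : pred {set I}) :
  (forall C : {set I}, G C -> coalition C0 S C && self_protecting P C) ->
  coalition C0 S (C0 :|: \bigcup_(C | G C) C) &&
  self_protecting P (C0 :|: \bigcup_(C | G C) C).
Proof.
move=> spG; set U := C0 :|: _.
have cU : coalition C0 S U.
  rewrite coalitionU ?coalition_vanguard //; apply/bigcupsP => C /spG.
  by case/andP=> /andP[].
rewrite cU; apply/forall_inP => i iU.
have iCS : i \in C0 :|: S by have /andP[_ /subsetP] := cU; apply.
have [iC0|/bigcupP[C GC iC]] := setUP iU.
  exact: mono iCS coalition_vanguard cU (subsetUl _ _) (vanguard_protected iC0).
have /andP[cC /forall_inP spC] := spG C GC.
apply: mono iCS cC cU _ (spC i iC).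
by apply: subset_trans (subsetUr _ _); apply: bigcup_sup GC.
Qed.

(** For [i] in [C] the set [C :|: [set i]] is [C], so the inclusion of [C] in its image under
    [Gamma] amounts to self-protection. For [i] outside [C] the test is the one in [Tmap], so the
    reverse inclusion amounts to closure under [Tmap]. *)
Lemma fixed_pointsP (C : {set I}) :
  reflect [/\ coalition C0 S C, self_protecting P C & Tmap S P C = C]
          (C \in fixed_points C0 S P).
Proof.
rewrite inE; apply: (iffP andP) => [[cC /eqP GC]|[cC /forall_inP spC TC]].
  have /andP[C0C _] := cC; split=> //.
    apply/forall_inP => i iC.
    have : i \in Gamma C0 S P C by rewrite GC.
    rewrite !inE => /orP[iC0|/andP[_]]; last by rewrite (setUidPl _) ?sub1set.
    apply: mono coalition_vanguard cC C0C (vanguard_protected iC0).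
    by rewrite inE iC0.
  apply/eqP; rewrite eqEsubset sub_Tmap andbT; apply/subsetP => i.
  rewrite !inE => /orP[//|/andP[/andP[_ iS] CiP]].
  by rewrite -GC !inE iS CiP orbT.
split=> //; have /andP[C0C /subsetP CS] := cC.
rewrite eqEsubset subUset C0C /=; apply/andP; split; apply/subsetP => i.
  rewrite inE => /andP[iS CiP]; rewrite -TC !inE iS CiP !andbT.
  exact: orbN.
move=> iC; have := CS i iC; rewrite !inE => /orP[->//|->].
by rewrite (setUidPl _) ?sub1set // spC // orbT.
Qed.

Lemma iter_Tmap_fixed_point (C : {set I}) :
  coalition C0 S C -> self_protecting P C ->
  iter #|S| (Tmap S P) C \in fixed_points C0 S P.
Proof.
move=> cC spC; apply/fixed_pointsP; split; last exact: Tmap_iter_Tmap.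
  exact: coalition_iter_Tmap.
exact: self_protecting_iter_Tmap.
Qed.

(** * Extremal fixed points and joins *)

Lemma Cminus_least : least_in (fixed_points C0 S P) (Cminus C0 S P).
Proof.
split=> [|C /fixed_pointsP[cC _ TC]].
  by apply: iter_Tmap_fixed_point; rewrite ?coalition_vanguard
    ?self_protecting_vanguard.
have /andP[C0C _] := cC.
exact: iter_Tmap_min coalition_vanguard cC C0C TC.
Qed.

Lemma Cplus_greatest : greatest_in (fixed_points C0 S P) (Cplus C0 S P).
Proof.
pose G := [pred C | coalition C0 S C && self_protecting P C].
have GP C : G C -> C \subset Cplus C0 S P by move=> GC; apply: bigcup_sup GC.
split=> [|C /fixed_pointsP[cC spC _]]; last by apply: GP; rewrite /= cC.
have GC0 : G C0 by rewrite /= coalition_vanguard self_protecting_vanguard.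
have /andP[] := self_protecting_bigcup (fun C (GC : G C) => GC).
(* The extra [C0] is absorbed, being itself a self-protecting coalition. *)
rewrite (setUidPr _) -/(Cplus C0 S P) => [cP spP|]; last exact: GP.
have KF := iter_Tmap_fixed_point cP spP.
(* The closure of [Cplus] is again a self-protecting coalition, hence one of the sets in the union
   defining [Cplus]. *)
suff <- : iter #|S| (Tmap S P) (Cplus C0 S P) = Cplus C0 S P by [].
apply/eqP; rewrite eqEsubset sub_iter_Tmap andbT GP //=.
by have /fixed_pointsP[-> ->] := KF.
Qed.

Lemma fixed_points_complete_lattice : complete_lattice (fixed_points C0 S P).
Proof.
apply: complete_lattice_of_joins => G /subsetP GF.
have spG C : C \in G -> coalition C0 S C && self_protecting P C.
  by move=> /GF /fixed_pointsP[-> ->].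
have /andP[cU spU] := @self_protecting_bigcup [in G] spG.
set U := C0 :|: _ in cU spU.
(* The union [U] is self-protecting but may fail to be closed under [Tmap]; for empty [G] this join
   is [Cminus]. *)
exists (iter #|S| (Tmap S P) U); split=> [|D].
  rewrite inE iter_Tmap_fixed_point //=; apply/forall_inP => Y YG.
  apply: subset_trans (sub_iter_Tmap _ _).
  by apply: subset_trans (subsetUr _ _); apply: bigcup_sup YG.
rewrite inE => /andP[/fixed_pointsP[cD _ TD] /forall_inP Dub].
have /andP[C0D _] := cD; apply: iter_Tmap_min => //.
by rewrite subUset C0D; apply/bigcupsP.
Qed.

(** * The bound for regret-free processes *)

Lemma regret_free_attempt (A : process I) (R : nat -> {set I}) (t : nat)
    (i : I) :
  regret_free C0 P A -> admissible A R -> i \in attempts_at A R t.+1 ->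
  coalition_at C0 R t :|: [set i] \in P i.
Proof.
move=> rfA admR iA.
(* follow [R] before date [t.+1], let only [i] complete there, nobody later *)
pose R' s := if s <= t then R s else if s == t.+1 then [set i] else set0.
have eqR s : s <= t -> history R' s = history R s.
  by move=> st; apply: eq_history => r rs; rewrite /R' (leq_trans rs st).
have admR' : admissible A R'.
  case=> // s _; rewrite {1}/R'; case: ltnP => [st|_].
    by rewrite /attempts_at (eqR s (ltnW st)); apply: admR.
  case: eqP => [[->]|_]; last exact: sub0set.
  (* Attempts at date [t.+1] depend only on the history up to [t], where [R'] agrees with [R]. *)
  by rewrite sub1set /attempts_at eqR.
have := rfA R' admR' t.+1 isT i.
rewrite coalition_atS {2 4}/R' ltnn eqxx /coalition_at eqR //.
by apply; rewrite !inE eqxx orbT.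
Qed.

Lemma regret_free_sub_Cminus (A : process I) (R : nat -> {set I}) (t : nat) :
  public_process C0 S A -> regret_free C0 P A -> admissible A R ->
  coalition_at C0 R t \subset Cminus C0 S P.
Proof.
move=> ppA rfA admR.
have /fixed_pointsP[cM _ TM] := Cminus_least.1.
elim: t => [|t IH]; first exact: sub_iter_Tmap.
rewrite coalition_atS subUset IH; apply/subsetP => i iR.
have iA := subsetP (admR t.+1 isT) i iR.
have iSC := subsetP (ppA R admR t.+1 isT) i iA.
have cC : coalition C0 S (coalition_at C0 R t).
  have /andP[_ MS] := cM.
  by rewrite /coalition coalition_at_vanguard (subset_trans IH).
(* Whoever joins lies in [Tmap] of the current coalition, hence in [Tmap] of [Cminus], which is
   [Cminus]. *)
rewrite -TM (subsetP (Tmap_mono cC cM IH)) // inE [X in _ || X]inE iSC.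
by rewrite (regret_free_attempt rfA admR iA) orbT.
Qed.

(** * The greedy process *)

Lemma greedy_public_process : public_process C0 S (greedy C0 S P).
Proof.
move=> R _ t _; apply/subsetP => i.
by rewrite !inE => /andP[/negPf -> /= /andP[]].
Qed.

Lemma greedy_self_protecting (R : nat -> {set I}) (t : nat) :
  admissible (greedy C0 S P) R ->
  coalition C0 S (coalition_at C0 R t) &&
  self_protecting P (coalition_at C0 R t).
Proof.
move=> admR; elim: t => [|t /andP[cC spC]].
  by rewrite coalition_vanguard self_protecting_vanguard.
have RT : R t.+1 \subset Tmap S P (coalition_at C0 R t).
  exact: subset_trans (admR t.+1 isT) (subsetDl _ _).
have /andP[_ TS] := coalition_Tmap cC.
rewrite coalition_atS coalitionU ?(subset_trans RT) //=.
apply: self_protecting_between cC spC (subsetUl _ _) _.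
by rewrite subUset sub_Tmap.
Qed.

Lemma greedy_regret_free : regret_free C0 P (greedy C0 S P).
Proof.
move=> R admR t _ i iC.
by have /andP[_ /forall_inP] := greedy_self_protecting t admR; apply.
Qed.

Lemma greedy_all_completed (R : nat -> {set I}) (t : nat) :
  all_completed (greedy C0 S P) R ->
  coalition_at C0 R t = iter t (Tmap S P) C0.
Proof.
move=> allR; elim: t => // t IH.
rewrite coalition_atS allR // /attempts_at /greedy /= -/(coalition_at C0 R t).
by rewrite IH -{1}(setIidPr (sub_Tmap (iter t _ C0))) setID.
Qed.

Lemma greedy_attains (R : nat -> {set I}) (t : nat) :
  all_completed (greedy C0 S P) R -> #|S| <= t ->
  coalition_at C0 R t = Cminus C0 S P.
Proof.
(* The [t - #|S|] further applications act on a set already fixed by [Tmap]. *)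
move=> allR /subnK <-; rewrite greedy_all_completed // iterD iter_fix //.
exact: Tmap_iter_Tmap coalition_vanguard.
Qed.

End Protection.

Theorem theorem2 (I : finType) (C0 N S : {set I}) (P : I -> {set {set I}})
    (hC0N : [disjoint C0 & N]) (hSN : S \subset N)
    (hP : protection_families C0 S P)
    (hmono : monotone_protection C0 S P) :
  (forall A : process I, public_process C0 S A -> regret_free C0 P A ->
     forall R : nat -> {set I}, admissible A R ->
     forall t : nat, 0 < t -> coalition_at C0 R t \subset Cminus C0 S P) /\
  (public_process C0 S (greedy C0 S P) /\
   regret_free C0 P (greedy C0 S P) /\
   forall R : nat -> {set I}, all_completed (greedy C0 S P) R ->
     exists2 t0 : nat, t0 <= #|S| &
       forall t : nat, t0 <= t -> coalition_at C0 R t = Cminus C0 S P) /\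
  (least_in (fixed_points C0 S P) (Cminus C0 S P) /\
   greatest_in (fixed_points C0 S P) (Cplus C0 S P) /\
   complete_lattice (fixed_points C0 S P)).
Proof.
have [_ hC0] := hP; split.
  by move=> A ppA rfA R admR t _; apply: regret_free_sub_Cminus rfA admR.
split; last first.
  split; first exact: Cminus_least.
  by split; [exact: Cplus_greatest | exact: fixed_points_complete_lattice].
split; first exact: greedy_public_process.
split; first exact: greedy_regret_free.
by move=> R allR; exists #|S| => // t; apply: greedy_attains.
Qed.
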